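(* Let $(R,\mathscr T,\mathfrak a^t)$ be a non-degenerately generated triple. Then there exist graded subalgebras $\mathscr T^1,\dots,\mathscr T^n\subseteq\mathscr T$ such that each triple $(R,\mathscr T^i,\mathfrak a^t)$ is pseudo-$\mathbb Q$-Gorenstein and such that $$\tau_b(R;\mathscr T,\mathfrak a^t)=\sum_{i=1}^n\tau_b(R;\mathscr T^i,\mathfrak a^t).$$
   Context: All rings are commutative, Noetherian, of characteristic $p>0$ and $F$-finite. $F^e_*M$ denotes an $R$-module $M$ viewed as an $R$-module via the $e$-fold iterated Frobenius ($F^e_*R$ is also a ring, equal to $R$); $F$-finite means $F_*R$ is a finitely generated $R$-module. For an ideal $I$, $F^e_*I\subseteq F^e_*R$, and $\phi(F^e_*I)$ denotes the image, an ideal of $R$. $R^\circ$ is the set of elements of $R$ not contained in any minimal prime. Convention: $\mathfrak a^0=R$. For reduced $R$, $\mathscr C(R)=\bigoplus_{e\ge0}\operatorname{Hom}_R(F^e_*R,R)$ is a non-commutative graded ring with product $\phi\cdot\psi=\phi\circ(F^d_*\psi)$ for $\phi\in\mathscr C(R)_d$, $\psi\in\mathscr C(R)_e$. $\mathscr C(R)_0\cong R$. Each $\mathscr C(R)_e$ is an $F^e_*R$-module by pre-multiplication, $(\phi\cdot x)(y)=\phi(xy)$. A pair $(R,\mathscr T)$ is a reduced $F$-finite ring $R$ with a graded subalgebra $\mathscr T\subseteq\mathscr C(R)$ such that $\mathscr T_0=\mathscr C(R)_0\cong R$ (all graded subalgebras forming pairs satisfy this; each $\mathscr T_e$ is then an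 $F^e_*R$-submodule). A triple $(R,\mathscr T,\mathfrak a^t)$ is a pair together with an ideal $\mathfrak a\subseteq R$ and a real number $t>0$. An element $\phi\in\mathscr T_e$ is non-degenerate if its image in $\operatorname{Hom}_{R_\eta}(F^e_*R_\eta,R_\eta)$ is nonzero for every minimal prime $\eta$ of $R$. The triple is non-degenerate if $\mathscr T_e$ contains a non-degenerate element for some $e>0$ and $\mathfrak a\cap R^\circ\ne\emptyset$. The triple is non-degenerately generated if, for every $e>0$ with $\mathscr T_e\ne0$, $\mathscr T_e$ is generated as an $F^e_*R$-module by non-degenerate elements, and $\mathfrak a\cap R^\circ\neq\emptyset$. A non-degenerate triple $(R,\mathscr T,\mathfrak a^t)$ is pseudo-$\mathbb Q$-Gorenstein if there is an integer $e_0>0$ such that (i) $\mathscr T_{e_0}\cong F^{e_0}_*R$ as $F^{e_0}_*R$-modules; (ii) for every $e>0$ and all $n,r\ge0$ with $e=ne_0+r$ ($r<e_0$ not required), the map $\mathscr T_{ne_0}\otimes_{F^{ne_0}_*R}F^{ne_0}_*\mathscr T_r\to\mathscr T_e$, $\phi\otimes F^{ne_0}_*\psi\mapsto\phi\circ(F^{ne_0}_*\psi)$, is an isomorphism of $F^e_*R$-modules. The big test ideal $\tau_b(R;\mathscr T,\mathfrak a^t)$ is, if it exists, the unique smallest ideal $J\subseteq R$ such that $J\cap R^\circ\ne\emptyset$ and $\phi(F^e_*(\mathfrak a^{\lceil t(p^e-1)\rceil}J))\subseteq J$ for all $e\ge0$ and all $\phi\in\mathscr T_e$; it exists for every non-degenerate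 triple.
   Formalization: The triple is also assumed non-degenerate; this excludes only the case T_e = 0 for all e > 0, where the claim fails (e.g. R = a = F_p, T = T_0: then τ_b = F_p, but no T^i is non-degenerate and the sum is 0). *)

(* Defs.v *)
From HB Require Import structures.
From mathcomp Require Import all_boot all_order all_algebra.
From mathcomp Require Import boolp classical_sets functions reals.

Set Implicit Arguments.
Unset Strict Implicit.
Unset Printing Implicit Defensive.

Import Order.TTheory GRing.Theory Num.Theory.

Local Open Scope classical_set_scope.
Local Open Scope ring_scope.

(* MathComp's [idealr] is restricted to proper ideals; here R itself counts. *)
Definition is_ideal (R : comNzRingType) (I : set R) : Prop :=
  [/\ I 0, (forall x y, I x -> I y -> I (x + y))
    & (forall r x, I x -> I (r * x))].

Definition ideal_gen (R : comNzRingType) (S : set R) : set R :=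
  [set x | exists n (c s : 'I_n -> R),
     (forall i, S (s i)) /\ x = \sum_(i < n) c i * s i].

Definition ideal_mul (R : comNzRingType) (I J : set R) : set R :=
  ideal_gen [set x | exists u v, [/\ I u, J v & x = u * v]].

Definition ideal_exp (R : comNzRingType) (I : set R) (n : nat) : set R :=
  iter n (ideal_mul I) setT.

Definition ideal_sum (R : comNzRingType) (n : nat) (J : 'I_n -> set R) :
    set R :=
  [set x | exists y : 'I_n -> R, (forall i, J i (y i)) /\ x = \sum_(i < n) y i].

Definition is_prime (R : comNzRingType) (P : set R) : Prop :=
  [/\ is_ideal P, ~ P 1 & forall x y, P (x * y) -> P x \/ P y].

Definition minimal_prime (R : comNzRingType) (P : set R) : Prop :=
  is_prime P /\ forall Q, is_prime Q -> Q `<=` P -> Q = P.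

Definition Rcirc (R : comNzRingType) : set R :=
  [set x | forall P, minimal_prime P -> ~ P x].

Definition reduced_ring (R : comNzRingType) : Prop :=
  forall (x : R) (n : nat), x ^+ n = 0 -> x = 0.

Definition noetherian_ring (R : comNzRingType) : Prop :=
  forall I : set R, is_ideal I ->
    exists n (g : 'I_n -> R), I = ideal_gen (range g).

Definition fg_module (R : comNzRingType) (M : lmodType R) : Prop :=
  exists n (g : 'I_n -> M),
    forall x, exists c : 'I_n -> R, x = \sum_(i < n) c i *: g i.

(* [Fpush hp e] is F^e_* R: the ring R, seen as an R-module through the e-th
   iterate of Frobenius. *)
Definition Fpush (R : comNzRingType) (p : nat) (hp : p \in [pchar R])
  (e : nat) : Type := R.

Section FpushModule.
Variables (R : comNzRingType) (p : nat) (hp : p \in [pchar R]) (e : nat).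

HB.instance Definition _ := GRing.ComNzRing.on (Fpush hp e).

Definition Fpush_scale (r : R) (x : Fpush hp e) : Fpush hp e :=
  (r ^+ (p ^ e) : R) * x.

Let scaleA a b v : Fpush_scale a (Fpush_scale b v) = Fpush_scale (a * b) v.
Proof. by rewrite /Fpush_scale mulrA exprMn. Qed.

Let scale1 : left_id 1 Fpush_scale.
Proof. by move=> v; rewrite /Fpush_scale expr1n mul1r. Qed.

Let scaleDr : right_distributive Fpush_scale +%R.
Proof. by move=> a u v; rewrite /Fpush_scale mulrDr. Qed.

Let scaleDl v : {morph Fpush_scale^~ v : a b / a + b}.
Proof.
move=> a b; rewrite /Fpush_scale -mulrDl exprDn_pchar //.
by rewrite pnatX (pnatE _ (pcharf_prime hp)) hp.
Qed.

HB.instance Definition _ := GRing.Zmodule_isLmodule.Build R (Fpush hp e)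
  scaleA scale1 scaleDr scaleDl.
End FpushModule.

Definition F_finite (R : comNzRingType) (p : nat) (hp : p \in [pchar R]) :
    Prop :=
  fg_module (Fpush hp 1).

(* Hom_R(F^e_* R, R), as a set of maps R -> R. *)
Definition cartier_hom (R : comNzRingType) (p : nat) (hp : p \in [pchar R])
    (e : nat) : set (R -> R) :=
  [set phi | linear (phi : Fpush hp e -> R^o)].

(* The F^e_*R-module structure of Hom_R(F^e_* R, R): (phi . x)(y) = phi(xy). *)
Definition premul (R : comNzRingType) (phi : R -> R) (x : R) : R -> R :=
  fun y => phi (x * y).

(* The R-module structure of Hom_R(F^e_* R, R) coming from the target. *)
Definition postmul (R : comNzRingType) (x : R) (phi : R -> R) : R -> R :=
  fun y => x * phi y.

(* A graded subring of C(R), given by its homogeneous components; on underlying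
   maps, phi o F^d_* psi is phi \o psi. *)
Definition graded_subalgebra (R : comNzRingType) (p : nat)
    (hp : p \in [pchar R]) (T : nat -> set (R -> R)) : Prop :=
  (forall e, [/\ T e `<=` cartier_hom hp e, T e 0,
      (forall phi psi, T e phi -> T e psi -> T e (phi + psi))
    & (forall phi, T e phi -> T e (- phi))]) /\
  T 0%N id /\
  (forall d e phi psi, T d phi -> T e psi -> T (d + e)%N (phi \o psi)).

Definition cartier_pair (R : comNzRingType) (p : nat) (hp : p \in [pchar R])
    (T : nat -> set (R -> R)) : Prop :=
  [/\ reduced_ring R, F_finite hp, graded_subalgebra hp T
    & T 0%N = cartier_hom hp 0].

Definition cartier_triple (R : comNzRingType) (p : nat) (hp : p \in [pchar R])
    (T : nat -> set (R -> R)) (a : set R) (K : realType) (t : K) : Prop :=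
  [/\ cartier_pair hp T, is_ideal a & 0 < t].

(* A pair u with u.2 outside eta stands for the fraction u.1 / u.2 of R_eta;
   [loc_eq eta] is equality of fractions. *)
Definition loc_eq (R : comNzRingType) (eta : set R) (u v : R * R) : Prop :=
  exists2 w, ~ eta w & w * (u.1 * v.2 - v.1 * u.2) = 0.

(* The map F^e_* R_eta -> R_eta induced by phi in Hom_R(F^e_* R, R): writing
   x / s = (s ^ (p^e - 1) * x) / s ^ (p^e), it sends x / s to
   phi (s ^ (p^e - 1) * x) / s. *)
Definition loc_map (R : comNzRingType) (p e : nat) (phi : R -> R) (u : R * R) :
    R * R :=
  (phi (u.2 ^+ (p ^ e - 1) * u.1), u.2).

Definition nondegenerate_elt (R : comNzRingType) (p e : nat) (phi : R -> R) :
    Prop :=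
  forall eta, minimal_prime eta ->
    exists u : R * R,
      ~ eta u.2 /\ ~ loc_eq eta (loc_map p e phi u) (0, 1).

Definition nondegenerate_triple (R : comNzRingType) (p : nat)
    (T : nat -> set (R -> R)) (a : set R) : Prop :=
  (exists e phi, [/\ (0 < e)%N, T e phi & nondegenerate_elt p e phi]) /\
  a `&` @Rcirc R !=set0.

Definition nondegenerately_generated (R : comNzRingType) (p : nat)
    (T : nat -> set (R -> R)) (a : set R) : Prop :=
  (forall e, (0 < e)%N -> (exists2 phi, T e phi & phi <> 0) ->
     forall phi, T e phi ->
       exists n (g : 'I_n -> R -> R) (x : 'I_n -> R),
         (forall i, T e (g i) /\ nondegenerate_elt p e (g i)) /\
         phi = \sum_(i < n) premul (g i) (x i)) /\
  a `&` @Rcirc R !=set0.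

(* Let M and N be submodules of U and V for scalar actions ra (written on the
   right) and la of a commutative ring A.  A sequence of elements of M x N
   stands for the sum of the corresponding pure tensors, and [tensor_eq] is
   equality in the tensor product of M and N over A: the congruence on the free
   commutative monoid on M x N generated by the bilinearity relations.  The
   quotient is a group, the opposite of (m, n) being (- m, n). *)
Inductive tensor_eq (A : comNzRingType) (U V : zmodType)
    (ra : U -> A -> U) (la : A -> V -> V) (M : set U) (N : set V) :
    seq (U * V) -> seq (U * V) -> Prop :=
| tensor_refl s : tensor_eq ra la M N s s
| tensor_sym s s' : tensor_eq ra la M N s s' -> tensor_eq ra la M N s' s
| tensor_trans s s' s'' :
    tensor_eq ra la M N s s' -> tensor_eq ra la M N s' s'' ->
    tensor_eq ra la M N s s''
| tensor_cat s1 s1' s2 s2' :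
    tensor_eq ra la M N s1 s1' -> tensor_eq ra la M N s2 s2' ->
    tensor_eq ra la M N (s1 ++ s2) (s1' ++ s2')
| tensor_swap x y : tensor_eq ra la M N [:: x; y] [:: y; x]
| tensor_0l n : N n -> tensor_eq ra la M N [:: (0, n)] [::]
| tensor_0r m : M m -> tensor_eq ra la M N [:: (m, 0)] [::]
| tensor_Dl m m' n : M m -> M m' -> N n ->
    tensor_eq ra la M N [:: (m + m', n)] [:: (m, n); (m', n)]
| tensor_Dr m n n' : M m -> N n -> N n' ->
    tensor_eq ra la M N [:: (m, n + n')] [:: (m, n); (m, n')]
| tensor_bal m a n : M m -> N n ->
    tensor_eq ra la M N [:: (ra m a, n)] [:: (m, la a n)].

Definition formal_tensor (U V : Type) (M : set U) (N : set V)
    (s : seq (U * V)) : Prop :=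
  foldr (fun q P => [/\ M q.1, N q.2 & P]) True s.

(* The map phi (x) F^d_* psi |-> phi o F^d_* psi, extended additively. *)
Definition tensor_comp (R : comNzRingType) (s : seq ((R -> R) * (R -> R))) :
    R -> R :=
  \sum_(q <- s) (q.1 \o q.2).

(* The F^(d+e)_*R-module structure of the tensor product of T_d and F^d_* T_e
   over F^d_* R is (phi (x) F^d_* psi) . y = phi (x) F^d_* (psi . y). *)
Definition tensor_premul (R : comNzRingType)
    (s : seq ((R -> R) * (R -> R))) (y : R) : seq ((R -> R) * (R -> R)) :=
  [seq (q.1, premul q.2 y) | q <- s].

(* The composition map from the tensor product of T_d and F^d_* T_e over F^d_* R
   to T_(d+e) is well defined and injective, with image T_(d+e), and it is
   F^(d+e)_*R-linear. *)
Definition comp_isomorphism (R : comNzRingType) (T : nat -> set (R -> R))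
    (d e : nat) : Prop :=
  let tensor := formal_tensor (T d) (T e) in
  let teq := tensor_eq (@premul R) (@postmul R) (T d) (T e) in
  [/\ (forall s s', tensor s -> tensor s' ->
         teq s s' <-> tensor_comp s = tensor_comp s'),
      (forall chi, T (d + e)%N chi <->
         exists2 s, tensor s & chi = tensor_comp s),
      (forall s s', tensor s -> tensor s' ->
         tensor_comp (s ++ s') = tensor_comp s + tensor_comp s')
    & (forall s y, tensor s ->
         tensor_comp (tensor_premul s y) = premul (tensor_comp s) y)].

(* T e is isomorphic to F^e_* R as an F^e_*R-module; as F^e_* R is R as a ring,
   the isomorphism is a map on R. *)
Definition free_of_rank_one (R : comNzRingType) (T : nat -> set (R -> R))
    (e : nat) : Prop :=
  exists f : R -> (R -> R),
    [/\ (forall x y, f (x + y) = f x + f y),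
        (forall x y, f (x * y) = premul (f y) x),
        injective f & range f = T e].

Definition pseudo_Q_Gorenstein (R : comNzRingType) (p : nat)
    (T : nat -> set (R -> R)) (a : set R) : Prop :=
  nondegenerate_triple p T a /\
  exists e0 : nat,
    [/\ (0 < e0)%N, free_of_rank_one T e0
      & forall n r, (0 < n * e0 + r)%N -> comp_isomorphism T (n * e0) r].

Definition test_exponent (K : realType) (t : K) (p e : nat) : nat :=
  `|Num.ceil (t * (p ^ e - 1)%:R)|%N.

Definition compatible_ideal (R : comNzRingType) (p : nat)
    (T : nat -> set (R -> R)) (a : set R) (K : realType) (t : K) (J : set R) :
    Prop :=
  [/\ is_ideal J, J `&` @Rcirc R !=set0
    & forall e phi, T e phi ->
        phi @` ideal_mul (ideal_exp a (test_exponent t p e)) J `<=` J].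

(* "tau is the big test ideal": a relation, since existence is not automatic;
   such a tau is unique. *)
Definition is_big_test_ideal (R : comNzRingType) (p : nat)
    (T : nat -> set (R -> R)) (a : set R) (K : realType) (t : K)
    (tau : set R) : Prop :=
  compatible_ideal p T a t tau /\
  forall J, compatible_ideal p T a t J -> tau `<=` J.

(* Main.v *)
Require Import Defs.
From mathcomp Require Import all_boot all_order all_algebra.
From mathcomp Require Import ring zify.
From mathcomp Require Import boolp classical_sets functions reals.

Set Implicit Arguments.
Unset Strict Implicit.
Unset Printing Implicit Defensive.

Import Order.TTheory GRing.Theory Num.Theory.

Local Open Scope classical_set_scope.
Local Open Scope ring_scope.

(** Every non-degenerate [phi] in [T_d], [d > 0], generates the subalgebra
    [T^phi] with [phi^n R] in degree [n d] and 0 in the other degrees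
    ([cyclic_subalgebra]).  It is pseudo-Q-Gorenstein, because a non-degenerate
    [phi] over a reduced ring gives an injection [x |-> phi (x _)].  Let [S] be
    the sum of all test ideals [tau (T^phi)].  As [R] is Noetherian, finitely
    many [phi] suffice.  An ideal compatible with [T] is compatible with each
    [T^phi], hence contains [S]; what has to be shown is that [S] itself is
    compatible with [T].  Since [T_e] is generated by non-degenerate elements
    [psi], this comes down to [psi (a^[e] tau (T^phi)) <= S], where [a^[e]] is
    the power of [a] that goes with degree [e].

    Suppose that a nonzerodivisor [b] lies in [tau (T^Phi)] for all the maps
    [Phi = psi o phi^n], [n >= 0], at once ([uniform_test_element]).  On the one
    hand, [tau (T^phi)] lies in the sum of the ideals [phi^n (a^[n d] b)], which
    is compatible with [T^phi].  On the other hand, [psi] maps [a^[e]] times this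
    sum into the sum of the [Phi (a^[e + n d] b)], and the term with index [n] is
    contained in [tau (T^Phi)], hence in [S] ([test_ideal_image]).

    To find [b], choose a nonzerodivisor [c] such that [phi] and [psi] have dual
    bases after inversion of [c] ([exists_dual_basis]); so do their composites.
    With such a basis, Krull's intersection theorem shows that some power of [c]
    lies in [Phi^k (d R)], for every nonzerodivisor [d] and some [k] depending on
    [d] ([iterated_image_has_power]).  A bound on the power follows by applying
    [Phi] again, and depends only on a power of [c] in [Phi (R)]; as [c^2] is in
    [Phi (R)] for all [n], the bound is uniform ([uniform_iterated_image]).
    Finally [b] is [c^5] times a power of an element of [a] that makes up for the
    powers of [a].

    Localization is avoided throughout: the complement of the minimal primes is
    the set of nonzerodivisors ([Rcirc_nzd]), a map is non-degenerate when it
    takes a nonzerodivisor as a value ([nondegenerate_eltP]), and denominators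
    are powers of [c]. *)

(** * Ideals of a Noetherian ring *)

Section Ideals.
Variable R : comNzRingType.
Implicit Types (I J S X : set R) (c d x y : R).

Lemma idealMr I x r : is_ideal I -> I x -> I (x * r).
Proof. by case=> _ _ IM Ix; rewrite mulrC; apply: IM. Qed.

Lemma ideal_sum_closed I (A : Type) (s : seq A) (P : pred A) (F : A -> R) :
  is_ideal I -> (forall i, I (F i)) -> I (\sum_(i <- s | P i) F i).
Proof. by case=> I0 ID _ IF; apply: big_ind. Qed.

Lemma ideal_gen_ideal (G : set R) : is_ideal (ideal_gen G).
Proof.
split.
- exists 0%N, (fun _ => 0), (fun _ => 0); split; first by case.
  by rewrite big_ord0.
- move=> _ _ [n [c [s [Gs ->]]]] [m [d [u [Gu ->]]]].
  exists (n + m)%N.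
  exists (fun i => match fintype.split i with inl j => c j | inr k => d k end).
  exists (fun i => match fintype.split i with inl j => s j | inr k => u k end).
  split; first by move=> i; case: fintype.split.
  rewrite big_split_ord /=; congr (_ + _); apply: eq_bigr => i _.
    by case: (split_ordP (lshift m i)) => j /eqP; rewrite eq_shift // => /eqP <-.
  by case: (split_ordP (rshift n i)) => j /eqP; rewrite eq_shift // => /eqP <-.
- move=> r _ [n [c [s [Gs ->]]]]; exists n, (fun i => r * c i), s; split=> //.
  by rewrite mulr_sumr; apply: eq_bigr => i _; rewrite mulrA.
Qed.

Lemma sub_ideal_gen (G : set R) : G `<=` ideal_gen G.
Proof.
move=> x Gx; exists 1%N, (fun _ => 1), (fun _ => x); split=> //.
by rewrite big_ord1 mul1r.
Qed.

Lemma ideal_gen_sub (G : set R) I : is_ideal I -> G `<=` I -> ideal_gen G `<=` I.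
Proof.
move=> idI GI _ [n [c [s [Gs ->]]]]; apply: ideal_sum_closed => // i.
by case: idI => _ _; apply; apply: GI.
Qed.

Lemma saturation_ideal c I :
  is_ideal I -> is_ideal [set x | exists m, I (c ^+ m * x)].
Proof.
move=> idI; have [I0 ID IM] := idI; split.
- by exists 0%N; rewrite mulr0.
- move=> x y [m Ix] [n Iy]; exists (m + n)%N; rewrite mulrDr; apply: ID.
    by rewrite addnC exprD -mulrA; apply: IM.
  by rewrite exprD -mulrA; apply: IM.
- by move=> r x [m Ix]; exists m; rewrite mulrCA; apply: IM.
Qed.

Hypothesis noethR : noetherian_ring R.

Lemma ascending_chain (I : nat -> set R) :
  (forall n, is_ideal (I n)) -> (forall n, I n `<=` I n.+1) ->
  exists N, forall n, I n `<=` I N.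
Proof.
move=> idI Iinc.
have Imono m n : (m <= n)%N -> I m `<=` I n.
  elim: n => [|n IHn]; first by rewrite leqn0 => /eqP ->.
  rewrite leq_eqVlt => /orP[/eqP -> //|/IHn ImIn].
  exact: subset_trans ImIn (Iinc n).
have idU : is_ideal [set x | exists n, I n x].
  split.
  - by exists 0%N; case: (idI 0%N).
  - move=> x y [m Ix] [n Iy]; exists (maxn m n).
    case: (idI (maxn m n)) => _ ID _; apply: ID.
      exact: Imono (leq_maxl m n) _ Ix.
    exact: Imono (leq_maxr m n) _ Iy.
  - by move=> r x [n Ix]; exists n; case: (idI n) => _ _; apply.
have [k [g eqU]] := noethR idU.
have /choice[N IN] i : exists n, I n (g i).
  suff : [set x | exists n, I n x] (g i) by [].
  by rewrite eqU; apply: sub_ideal_gen; exists i.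
exists (\max_i N i) => n x Inx.
have : [set x | exists n, I n x] x by exists n.
rewrite eqU; apply: ideal_gen_sub => // _ [i _ <-].
exact: Imono (leq_bigmax i) _ (IN i).
Qed.

Lemma maximal_ideal_in (P : set (set R)) :
  P !=set0 -> (forall I, P I -> is_ideal I) ->
  exists M, P M /\ forall I, P I -> M `<=` I -> I `<=` M.
Proof.
move=> [M0 PM0] idP; apply: contrapT => noM.
have /choice[f fP] (M : {M | P M}) :
    exists I : {I | P I}, sval M `<=` sval I /\ ~ sval I `<=` sval M.
  apply: contrapT => noI; apply: noM; exists (sval M).
  split; first exact: (svalP M).
  move=> I PI MI; apply: contrapT => IM.
  by apply: noI; exists (exist _ I PI).
pose chain n := iter n f (exist _ M0 PM0).
have [N chainN] := @ascending_chain (fun n => sval (chain n))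
  (fun n => idP _ (svalP (chain n))) (fun n => (fP (chain n)).1).
exact: (fP (chain N)).2 (chainN N.+1).
Qed.

(** This contains Krull's intersection theorem, by an argument of Herstein: if
    [S = I d] and [d] lies in every power of [I], then [d] lies in [X], hence in
    [I d].  For [X] take a maximal one among the ideals that contain [S] and meet
    [(d)] inside [S]: if [f] is in [I] and [(X : f^n)] is stationary from [n = m]
    on, then [X + (f^m)] is another one. *)
Lemma krull_herstein I S d :
  is_ideal S -> (forall x, I x -> S (x * d)) ->
  exists X, [/\ is_ideal X, (forall s, X (s * d) -> S (s * d))
    & forall f, I f -> exists m, X (f ^+ m)].
Proof.
move=> idS SI.
pose P : set (set R) := [set X | [/\ is_ideal X, S `<=` X
  & forall s, X (s * d) -> S (s * d)]].
have [||X [[idX SX Xd] Xmax]] := @maximal_ideal_in P.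
- by exists S; split.
- by move=> X [].
exists X; split=> // f If; have [X0 XD XM] := idX.
have [||m stable] := @ascending_chain (fun n => [set r | X (f ^+ n * r)]).
- move=> n; split; first by rewrite /= mulr0.
    by move=> x y; rewrite /= mulrDr; apply: XD.
  by move=> r x /= Xx; rewrite mulrCA; apply: XM.
- by move=> n r /= Xr; rewrite exprS -mulrA; apply: XM.
exists m.
pose X' : set R := [set z | exists x r, X x /\ z = x + f ^+ m * r].
apply: (Xmax X'); first split.
- split.
  + by exists 0, 0; rewrite mulr0 addr0.
  + move=> _ _ [x [r [Xx ->]]] [y [s [Xy ->]]]; exists (x + y), (r + s).
    by split; [exact: XD | ring].
  + move=> u _ [x [r [Xx ->]]]; exists (u * x), (u * r).
    by split; [exact: XM | ring].
- by move=> x /SX Xx; exists x, 0; rewrite mulr0 addr0.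
- move=> s [x [r [Xx eqs]]]; apply: (Xd); rewrite eqs; apply: (XD) => //.
  apply: (stable m.+1); rewrite /=.
  have -> : f ^+ m.+1 * r = s * (f * d) + (- f) * x.
    by rewrite mulrCA eqs exprS; ring.
  by apply: (XD); [apply: (XM); apply: (SX); apply: (SI) | apply: (XM)].
- by move=> x Xx; exists x, 0; rewrite mulr0 addr0.
- by exists 0, 1; rewrite add0r mulr1.
Qed.

End Ideals.

(** * Nonzerodivisors of a reduced Noetherian ring *)

Definition nzd (R : comNzRingType) (x : R) : Prop :=
  forall y, x * y = 0 -> y = 0.

Section Nonzerodivisors.
Variable R : comNzRingType.
Implicit Types x y z : R.

Lemma nzd1 : nzd (1 : R).
Proof. by move=> y; rewrite mul1r. Qed.

Lemma nzdM x y : nzd x -> nzd y -> nzd (x * y).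
Proof. by move=> nx ny z; rewrite -mulrA => /nx /ny. Qed.

Lemma nzdX x n : nzd x -> nzd (x ^+ n).
Proof.
move=> nx; elim: n => [|n IHn]; first by rewrite expr0; apply: nzd1.
by rewrite exprS; apply: nzdM.
Qed.

Lemma nzd_inj x y z : nzd x -> x * y = x * z -> y = z.
Proof.
move=> nx eqyz; apply/eqP; rewrite -subr_eq0; apply/eqP/nx.
by rewrite mulrBr eqyz subrr.
Qed.

Hypothesis redR : reduced_ring R.

Lemma reduced_mulX x y n : (0 < n)%N -> x * y ^+ n = 0 -> x * y = 0.
Proof.
move=> n_gt0 xy0; apply: (redR (n := n)).
by rewrite exprMn -(prednK n_gt0) [x ^+ _]exprS mulrAC prednK // xy0 mul0r.
Qed.

Hypothesis noethR : noetherian_ring R.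

(** The substitute for prime avoidance.  Take [x] in [I] with the smallest
    annihilator; if [w x = 0] and [w a <> 0] for some [a] in [I], then
    [x + w a] has a strictly smaller one, because [x] and [w a] are
    orthogonal.  Minimal annihilators are obtained as maximal biannihilators. *)
Lemma faithful_ideal_has_nzd (I : set R) :
  is_ideal I -> (forall r, (forall x, I x -> r * x = 0) -> r = 0) ->
  exists2 x, I x & nzd x.
Proof.
move=> idI faithI; have [I0 ID IM] := idI.
pose biann x : set R := [set s | forall r, x * r = 0 -> s * r = 0].
have idB x : is_ideal (biann x).
  split; first by move=> r _; rewrite mul0r.
    by move=> s u Bs Bu r xr; rewrite mulrDl Bs // Bu // addr0.
  by move=> u s Bs r xr; rewrite -mulrA Bs // mulr0.
have [||_ [[x Ix <-] xmax]] := maximal_ideal_in noethR (P := biann @` I).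
- by exists (biann 0), 0.
- by move=> _ [x _ <-].
exists x => // w xw; apply: faithI => a Ia.
set z := w * a.
have xz : x * z = 0 by rewrite mulrA xw mul0r.
have zz : z * z = 0.
  have Bxz : biann (x + z) `<=` biann x.
    apply: xmax; first by exists (x + z) => //; apply: ID => //; apply: IM.
    move=> s Bs r xzr; apply: Bs.
    have : r * x ^+ 2 = 0.
      have -> : r * x ^+ 2 = x * ((x + z) * r) - r * (x * z) by ring.
      by rewrite xzr xz !mulr0 subrr.
    by rewrite [x * r]mulrC; apply: reduced_mulX.
  have : (x + z) * z = 0 by apply: (Bxz (x + z)).
  by rewrite mulrDl xz add0r.
by apply: (redR (n := 2)).
Qed.

Lemma nzd_annihilator x : exists2 b, x * b = 0 & nzd (x + b).
Proof.
pose I : set R := [set y | exists s b, x * b = 0 /\ y = s * x + b].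
have [||_ [s [b [xb ->]]] nsb] := @faithful_ideal_has_nzd I.
- split.
  + by exists 0, 0; rewrite mulr0 mul0r addr0.
  + move=> _ _ [s [b [xb ->]]] [u [e [xe ->]]]; exists (s + u), (b + e).
    by split; [rewrite mulrDr xb xe addr0 | ring].
  + move=> r _ [s [b [xb ->]]]; exists (r * s), (r * b).
    by split; [rewrite mulrCA xb mulr0 | ring].
- move=> r rI; have xr : x * r = 0.
    by rewrite mulrC; apply: rI; exists 1, 0; rewrite mulr0 mul1r addr0.
  apply: (redR (n := 2)); rewrite expr2.
  by apply: rI; exists 0, r; rewrite mul0r add0r.
exists b => // r xbr; apply: nsb.
have xr : x * r = 0.
  rewrite mulrC; apply: (reduced_mulX (n := 2)) => //.
  have -> : r * x ^+ 2 = x * ((x + b) * r) - r * (x * b) by ring.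
  by rewrite xbr xb !mulr0 subrr.
by move: xbr; rewrite !mulrDl xr add0r => ->; rewrite -mulrA xr mulr0 addr0.
Qed.

(** A maximal one among the annihilators of nonzero multiples of [x] is prime.
    It is minimal because a prime [Q] inside the annihilator of [z = x y] does
    not contain [z], as [z^2 <> 0], so that it contains the annihilator. *)
Lemma minimal_prime_avoiding x : x <> 0 ->
  exists y, x * y <> 0 /\ minimal_prime [set r | x * y * r = 0].
Proof.
move=> x0; pose ann y : set R := [set r | x * y * r = 0].
have idA y : is_ideal (ann y).
  split; first by rewrite /ann /= mulr0.
    by move=> r s; rewrite /ann /= mulrDr => -> ->; rewrite addr0.
  by move=> r s; rewrite /ann /= mulrCA => ->; rewrite mulr0.
have [||_ [[y xy <-] ymax]] :=
  maximal_ideal_in noethR (P := ann @` [set y | x * y <> 0]).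
- by exists (ann 1), 1; rewrite //= mulr1.
- by move=> _ [y _ <-].
exists y; split=> //.
have prime_y : is_prime (ann y).
  split=> //; first by rewrite /ann /= mulr1.
  move=> r s; rewrite /ann /= => xyrs.
  have [->|/eqP xyr] := eqVneq (x * y * r) 0; [by left | right].
  have sub : ann (y * r) `<=` ann y.
    apply: ymax; first by exists (y * r) => //=; rewrite mulrA.
    by move=> u; rewrite /ann /= => xyu; rewrite mulrA mulrAC xyu mul0r.
  by apply: sub; rewrite /ann /= !mulrA -!mulrA in xyrs *.
split=> // Q primeQ Qy; rewrite eqEsubset; split=> // r.
rewrite /ann /= => xyr.
have [[Q0 _ _] _ primeQM] := primeQ.
case: (primeQM (x * y) r); rewrite ?xyr //.
move=> /Qy; rewrite /ann /= -expr2 => xy2.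
by case: xy; apply: redR xy2.
Qed.

(** If [x] lay in a minimal prime [P], then 0 would not be a product of a power
    of [x] with an element outside [P], so an ideal maximal among those that
    contain no such product would be a prime properly contained in [P]. *)
Lemma Rcirc_nzd x : @Rcirc R x <-> nzd x.
Proof.
split=> [Rx w xw | nx P minP Px].
  apply: contrapT => w0; have [y [_ /Rx]] := minimal_prime_avoiding w0.
  by apply; rewrite /= mulrAC [w * x]mulrC xw mul0r.
have [[idP P1 PM] minP'] := minP.
pose fam : set (set R) := [set Q | is_ideal Q /\
  forall n w, Q (x ^+ n * w) -> P w].
have [||Q [[idQ Qx] Qmax]] := maximal_ideal_in noethR (P := fam).
- exists [set 0]; split.
    split=> // [u v|r u] /= ->; first by move->; rewrite addr0.
    by rewrite mulr0.
  by move=> n w /= /(nzdX nx) ->; case: idP.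
- by move=> Q [].
have [Q0 QD QM] := idQ.
(* enlarging Q by an element u outside it leads out of the family *)
have outside u : ~ Q u -> exists n w r, Q (x ^+ n * w + r * u) /\ ~ P w.
  move=> Qu; apply: contrapT => none; apply: Qu.
  apply: (Qmax [set z | exists v r, Q v /\ z = v + r * u]); first split.
  - split.
    + by exists 0, 0; rewrite mul0r addr0.
    + move=> _ _ [v [r [Qv ->]]] [v' [r' [Qv' ->]]]; exists (v + v'), (r + r').
      by split; [exact: QD | ring].
    + move=> s _ [v [r [Qv ->]]]; exists (s * v), (s * r).
      by split; [exact: QM | ring].
  - move=> n w [v [r [Qv eqw]]]; apply: contrapT => Pw; apply: none.
    by exists n, w, (- r); split=> //; rewrite eqw mulNr addrK.
  - by move=> v Qv; exists v, 0; rewrite mul0r addr0.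
  - by exists 0, 1; rewrite mul1r add0r.
have primeQ : is_prime Q.
  split=> //; first by move=> Q1; apply: P1; apply: (Qx 0%N); rewrite mul1r.
  move=> u v Quv; apply: contrapT => /not_orP[/outside[n [w [r [Qw Pw]]]]].
  move=> /outside[n' [w' [r' [Qw' Pw']]]].
  have : P (w * w').
    apply: (Qx (n + n')%N).
    have -> : x ^+ (n + n') * (w * w') =
        (x ^+ n' * w') * (x ^+ n * w + r * u) +
        ((- (r * u)) * (x ^+ n' * w' + r' * v) + (r * r') * (u * v)).
      by rewrite exprD; ring.
    by apply: (QD); [apply: (QM) | apply: (QD); apply: (QM)].
  by case/PM.
have QP : Q = P.
  by apply: minP' => // w Qw; apply: (Qx 0%N); rewrite mul1r.
by apply: P1; apply: (Qx 1%N); rewrite expr1 mulr1 QP.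
Qed.

End Nonzerodivisors.

(** * Maps in Hom(F^e_* R, R) *)

Section CartierMaps.
Variables (R : comNzRingType) (p : nat) (hp : p \in [pchar R]).
Implicit Types (phi psi : R -> R) (I J : set R) (x y r c d : R).

Lemma pexp_gt0 e : (0 < p ^ e)%N.
Proof. by rewrite expn_gt0 prime_gt0 // (pcharf_prime hp). Qed.

Lemma pexp_gt1 e : (0 < e)%N -> (1 < p ^ e)%N.
Proof. by move=> e0; rewrite -(expn0 p) ltn_exp2l // prime_gt1 // (pcharf_prime hp). Qed.

Lemma frobD e x y : (x + y) ^+ (p ^ e) = x ^+ (p ^ e) + y ^+ (p ^ e).
Proof. by rewrite exprDn_pchar // pnatX (pnatE _ (pcharf_prime hp)) hp. Qed.

Lemma frob_sum e (A : Type) (s : seq A) (P : pred A) (F : A -> R) :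
  (\sum_(i <- s | P i) F i) ^+ (p ^ e) = \sum_(i <- s | P i) F i ^+ (p ^ e).
Proof.
apply: (big_morph (fun x => x ^+ (p ^ e))); first exact: frobD.
by rewrite expr0n eqn0Ngt pexp_gt0.
Qed.

Lemma cartier_homP e phi : cartier_hom hp e phi <->
  (forall x y, phi (x + y) = phi x + phi y) /\
  (forall r x, phi (r ^+ (p ^ e) * x) = r * phi x).
Proof.
split=> [lin | [phiD phiZ] r x y]; last by rewrite phiD phiZ.
have phi0 : phi 0 = 0.
  have := lin 1 0 0; rewrite scaler0 addr0 => /eqP.
  by rewrite scale1r -[X in X == _]addr0 (inj_eq (addrI _)) eq_sym => /eqP.
have lin' r x y : phi (r ^+ (p ^ e) * x + y) = r * phi x + phi y := lin r x y.
split=> [x y | r x].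
  by have := lin' 1 x y; rewrite expr1n !mul1r.
by have := lin' r x 0; rewrite phi0 !addr0.
Qed.

Lemma cartierD e phi x y :
  cartier_hom hp e phi -> phi (x + y) = phi x + phi y.
Proof. by move/cartier_homP=> [-> _]. Qed.

Lemma cartierZ e phi r x :
  cartier_hom hp e phi -> r * phi x = phi (r ^+ (p ^ e) * x).
Proof. by move/cartier_homP=> [_ ->]. Qed.

Lemma cartier0 e phi : cartier_hom hp e phi -> phi 0 = 0.
Proof. by move=> hom; rewrite -[0 in LHS](mulr0 (0 ^+ (p ^ e))) -(cartierZ _ _ hom) mul0r. Qed.

Lemma cartierB e phi x y :
  cartier_hom hp e phi -> phi (x - y) = phi x - phi y.
Proof.
by move=> hom; apply/eqP; rewrite eq_sym subr_eq -(cartierD _ _ hom) subrK.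
Qed.

Lemma cartier_sum e phi (A : Type) (s : seq A) (P : pred A) (F : A -> R) :
  cartier_hom hp e phi ->
  phi (\sum_(i <- s | P i) F i) = \sum_(i <- s | P i) phi (F i).
Proof.
move=> hom; apply: (big_morph phi); last exact: cartier0 hom.
by move=> x y; apply: cartierD hom.
Qed.

Lemma cartier_comp (d e : nat) phi psi : cartier_hom hp d phi -> cartier_hom hp e psi ->
  cartier_hom hp (d + e) (phi \o psi).
Proof.
move=> hphi hpsi; apply/cartier_homP; split=> [x y | r x] /=.
  by rewrite (cartierD _ _ hpsi) (cartierD _ _ hphi).
by rewrite expnD exprM -(cartierZ _ _ hpsi) -(cartierZ _ _ hphi).
Qed.

Lemma cartier_id : cartier_hom hp 0 id.
Proof. by apply/cartier_homP; split=> // r x; rewrite expr1. Qed.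

Lemma cartier_iter e phi n :
  cartier_hom hp e phi -> cartier_hom hp (n * e) (iter n phi).
Proof.
move=> hom; elim: n => [|n IHn]; first exact: cartier_id.
by rewrite mulSn; apply: (cartier_comp hom IHn).
Qed.

Lemma cartier_premul e phi x :
  cartier_hom hp e phi -> cartier_hom hp e (premul phi x).
Proof.
move=> hom; apply/cartier_homP; rewrite /premul; split=> [y z | r y].
  by rewrite mulrDr (cartierD _ _ hom).
by rewrite mulrCA -(cartierZ _ _ hom).
Qed.

Lemma cartier_image_ideal e phi d :
  cartier_hom hp e phi -> is_ideal [set y | exists r, y = phi (d * r)].
Proof.
move=> hom; split.
- by exists 0; rewrite mulr0 (cartier0 hom).
- move=> _ _ [r ->] [s ->]; exists (r + s).
  by rewrite mulrDr (cartierD _ _ hom).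
- move=> u _ [r ->]; exists (u ^+ (p ^ e) * r).
  by rewrite (cartierZ _ _ hom) mulrCA.
Qed.

Lemma image_ideal_mul_sub e phi I J L : cartier_hom hp e phi -> is_ideal I ->
  is_ideal L -> (forall u v, I u -> J v -> L (phi (u * v))) ->
  phi @` ideal_mul I J `<=` L.
Proof.
move=> hom idI idL uvL _ [x [n [c [s [sIJ ->]]]] <-].
rewrite (cartier_sum _ _ _ hom); apply: ideal_sum_closed => // i.
have [u [v [Iu Jv ->]]] := sIJ i.
by rewrite mulrA; apply: uvL => //; case: idI => _ _; apply.
Qed.

(** * Dual bases *)

(** Up to the factor [c], the pairs [(u, v)] in [s] form a dual basis
    [(u, phi (v * _))] of [F^e_* R] over [R], all of whose functionals are
    multiples of [phi]. *)
Definition dual_basis e phi c : Prop :=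
  exists s : seq (R * R),
    forall x, c * x = \sum_(w <- s) phi (w.2 * x) ^+ (p ^ e) * w.1.

Lemma dual_basis_mul e phi c r : dual_basis e phi c -> dual_basis e phi (r * c).
Proof.
case=> s sP; exists [seq (r * w.1, w.2) | w <- s] => x.
rewrite big_map /= -mulrA sP mulr_sumr; apply: eq_bigr => w _.
by rewrite mulrCA.
Qed.

Lemma dual_basis_comp (d e : nat) phi psi b c : cartier_hom hp e psi ->
  dual_basis d phi b -> dual_basis e psi c ->
  dual_basis (d + e) (phi \o psi) (b ^+ (p ^ e) * c).
Proof.
move=> hpsi [sphi phiP] [spsi psiP].
exists [seq (w'.1 ^+ (p ^ e) * w.1, w'.2 ^+ (p ^ e) * w.2) | w <- spsi, w' <- sphi].
move=> x; rewrite big_allpairs_dep /= -mulrA psiP mulr_sumr.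
apply: eq_bigr => w _.
rewrite mulrA -exprMn phiP frob_sum mulr_suml; apply: eq_bigr => w' _.
by rewrite (cartierZ _ _ hpsi) exprMn -exprM -expnD !mulrA.
Qed.

Lemma dual_basis_iter e phi c n : cartier_hom hp e phi ->
  dual_basis e phi c -> exists m, dual_basis (n * e) (iter n phi) (c ^+ m).
Proof.
move=> hom Dphi; elim: n => [|n [m IHn]].
  exists 0%N, [:: (1, 1)] => x.
  by rewrite big_seq1 /= !mul1r mulr1.
exists (p ^ (n * e) + m)%N; rewrite exprD mulSn.
exact: (dual_basis_comp (cartier_iter hom) Dphi IHn).
Qed.

Definition frobenius_generators e (A : finType) (g : A -> R) : Prop :=
  forall x, exists c : A -> R, x = \sum_i c i ^+ (p ^ e) * g i.

Lemma F_finite_generators e : F_finite hp ->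
  exists (A : finType) (g : A -> R), frobenius_generators e g.
Proof.
case=> n [g gP]; elim: e => [|e [A [f fP]]].
  by exists unit, (fun _ => 1) => x; exists (fun _ => x); rewrite big_const card_unit /= mulr1 addr0.
exists (A * 'I_n)%type, (fun u => (g u.2 : R) ^+ (p ^ e) * f u.1) => x.
have [c ->] := fP x.
have /choice[b bP] i : exists b : 'I_n -> R, c i = \sum_j b j ^+ p * (g j : R).
  have [b cb] := gP (c i : Fpush hp 1); exists b; rewrite [LHS]cb.
  by apply: eq_bigr => j _.
exists (fun u => b u.1 u.2); rewrite -(pair_bigA _ (fun i j => b i j ^+ (p ^ e.+1) * (g j ^+ (p ^ e) * f i))) /=.
apply: eq_bigr => i _; rewrite bP frob_sum mulr_suml; apply: eq_bigr => j _.
by rewrite exprMn -exprM -expnS mulrA.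
Qed.

(** Over each residue field [K] at a minimal prime, [Hom(F^e_* K, K)] is a line
    over [F^e_* K], so the form [(x, y) |-> phi (x y)] is perfect; [c] clears the
    denominators of a dual basis.  The proof is a Gram-Schmidt process which
    works at all minimal primes at once.  Suppose that
    [E x = \sum phi (v x)^q u] agrees with [c x] on some of the generators, and
    let [h] be the defect [E g - c g] at the next one.  The map
    [x |-> phi (v x)^q h] multiplies [h] by [phi (v h)^q], which for
    [v = h^(q-1) y] is [(h phi y)^q]; composed with [E - c], it corrects the
    defect.  Where [h] vanishes nothing has to be corrected, whence the summand
    [b] of the new factor, taken from the annihilator of [h]. *)
Lemma exists_dual_basis e phi y : reduced_ring R -> noetherian_ring R ->
  F_finite hp -> cartier_hom hp e phi -> nzd (phi y) ->
  exists2 c, nzd c & dual_basis e phi c.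
Proof.
move=> redR noethR finR hom nzd_y; set q := (p ^ e)%N.
have q_gt0 : (0 < q)%N := pexp_gt0 e.
have [A [g gP]] := F_finite_generators e finR.
pose E (s : seq (R * R)) x := \sum_(w <- s) phi (w.2 * x) ^+ q * w.1.
suff /(_ (enum A))[c [s [nzd_c sP]]] : forall r : seq A, exists c s,
    nzd c /\ forall i, i \in r -> E s (g i) = c * g i.
  exists c => //; exists s => x; rewrite -/(E s x).
  have [b ->] := gP x; rewrite /E mulr_sumr.
  under [RHS]eq_bigr => w _.
    rewrite mulr_sumr (cartier_sum _ _ _ hom) frob_sum mulr_suml.
    under eq_bigr => i _ do rewrite mulrCA -(cartierZ _ _ hom) exprMn -mulrA.
    over.
  rewrite exchange_big; apply: eq_bigr => i _ /=.
  by rewrite -mulr_sumr -/(E s (g i)) sP ?mem_enum // mulrCA.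
elim=> [|i0 r [c [s [nzd_c sP]]]]; first by exists 1, [::]; split=> //; apply: nzd1.
set h := E s (g i0) - c * g i0.
have [b hb nzd_hb] := nzd_annihilator redR noethR h.
pose v := h ^+ q.-1 * y; pose c' := (h * phi y) ^+ q + b.
have phi_vh : phi (v * h) = h * phi y.
  by rewrite (cartierZ _ _ hom) -/q -(prednK q_gt0) exprSr /v mulrAC.
(* E' x = c' E x - phi (v (E x - c x))^q h *)
pose s' := [seq (c' * w.1, w.2) | w <- s] ++
  [seq (- (phi (v * w.1) ^+ q * h), w.2) | w <- s] ++ [:: (h, v * c)].
have EP x : E s' x = c' * E s x - phi (v * (E s x - c * x)) ^+ q * h.
  rewrite /E !big_cat !big_map big_seq1 /= -/(E s x).
  have -> : phi (v * (E s x - c * x)) ^+ q =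
      \sum_(w <- s) phi (w.2 * x) ^+ q * phi (v * w.1) ^+ q - phi (v * c * x) ^+ q.
    rewrite mulrBr (cartierB _ _ hom) mulrA /E mulr_sumr (cartier_sum _ _ _ hom).
    apply/eqP; rewrite eq_sym subr_eq -frobD subrK frob_sum; apply/eqP.
    apply: eq_bigr => w _.
    by rewrite mulrCA -(cartierZ _ _ hom) exprMn.
  rewrite mulrBl opprB addrA [_ * h - _]addrC addrA; congr (_ + _).
  rewrite mulr_sumr mulr_suml -sumrN; congr (_ + _); apply: eq_bigr => w _; ring.
exists (c' * c), s'; split.
  apply: nzdM => // u cu; apply: nzd_hb.
  have hu : u * h = 0.
    apply: (reduced_mulX redR (n := q.+1)) => //.
    apply: (nzdX (n := q) nzd_y).
    have -> : phi y ^+ q * (u * h ^+ q.+1) = h * (c' * u) - h * b * u.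
      by rewrite /c' exprMn exprS; ring.
    by rewrite cu hb mulr0 mul0r subrr.
  have hq : h ^+ q = h ^+ q.-1 * h by rewrite -exprSr prednK.
  have -> : (h + b) * u =
      u * h + (c' * u - h ^+ q.-1 * phi y ^+ q * (u * h)).
    by rewrite /c' exprMn hq; ring.
  by rewrite hu cu mulr0 subrr addr0.
move=> i; rewrite inE EP => /orP[/eqP -> | /sP ->].
  rewrite -/h phi_vh.
  have -> : E s (g i0) = c * g i0 + h by rewrite /h addrC subrK.
  rewrite mulrDr -addrA [c' * h]mulrDl [b * h]mulrC hb addr0.
  by rewrite subrr addr0 mulrA.
by rewrite subrr mulr0 (cartier0 hom) expr0n eqn0Ngt q_gt0 mul0r subr0 mulrA.
Qed.

End CartierMaps.

(** * Powers of c in the iterated images of (d) *)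

Section IteratedImages.
Variables (R : comNzRingType) (p : nat) (hp : p \in [pchar R]).
Hypothesis noethR : noetherian_ring R.
Implicit Types (phi psi : R -> R) (c d : R).

(** This is strong F-regularity of [R_c] with respect to [phi].  Let [I n] be
    the preimage in [R] of [phi^n (d R_c)].  By the dual basis, [I n R_c] is the
    smallest ideal [J] of [R_c] with [d] in the Frobenius power [J^[q^n]];
    therefore the [I n] increase.  If [I] is the last of them, [d] is in
    [I^[q^n] R_c] for all [n], and [krull_herstein] puts [c^m d] into [I d] for
    some [m].  Then [c^m] lies in [I]. *)
Lemma iterated_image_has_power e phi c d : (0 < e)%N ->
  cartier_hom hp e phi -> dual_basis p e phi c -> nzd c -> nzd d ->
  exists n m r, c ^+ m = iter n phi (d * r).
Proof.
move=> e_gt0 hom Dphi nzd_c nzd_d.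
have homi n : cartier_hom hp (n * e) (iter n phi) by apply: cartier_iter.
pose im n : set R := [set y | exists r, y = iter n phi (d * r)].
pose I n : set R := [set x | exists m, im n (c ^+ m * x)].
have idim n : is_ideal (im n) := cartier_image_ideal d (homi n).
have idI n : is_ideal (I n) := saturation_ideal c (idim n).
have imI n x : im n x -> I n x by exists 0%N; rewrite mul1r.
have [||N stable] := ascending_chain noethR (I := I) => //.
  move=> n x [m [r eqx]]; have [M [s sP]] := dual_basis_iter n.+1 hom Dphi.
  exists (M + m)%N; rewrite exprD -mulrA eqx (cartierZ _ _ (homi n)).
  rewrite -(prednK (pexp_gt0 hp (n * e))) exprSr -mulrA sP mulr_sumr.
  rewrite (cartier_sum _ _ _ (homi n)); apply: ideal_sum_closed => // w.
  rewrite mulSn expnD exprM mulrCA -(cartierZ _ _ (homi n)).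
  apply: idealMr => //; rewrite -(prednK (pexp_gt0 hp e)) exprS.
  by apply: idealMr => //; exists (w.2 * r); rewrite mulrCA.
have idId : is_ideal [set y | exists2 f, I N f & y = f * d].
  have [I0 ID IM] := idI N; split.
  - by exists 0; rewrite ?mul0r.
  - by move=> _ _ [f If ->] [g Ig ->]; exists (f + g); [apply: ID | rewrite mulrDl].
  - by move=> u _ [f If ->]; exists (u * f); [apply: IM | rewrite mulrA].
have [|X [idX Xd Xpow]] := krull_herstein noethR (I := I N) (d := d)
    (saturation_ideal c idId).
  by move=> f If; exists 0%N; rewrite mul1r; exists f.
have [k [g eqI]] := noethR (idI N).
have /choice[M gM] i : exists m, X (g i ^+ m).
  by apply: Xpow; rewrite eqI; apply: sub_ideal_gen; exists i.
pose n := (N + \max_i M i)%N.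
have XI y : I N y -> X (y ^+ (p ^ (n * e))).
  rewrite eqI => -[l [a [s [sg ->]]]]; rewrite frob_sum //.
  apply: ideal_sum_closed => // j; have [i _ <-] := sg j.
  have le_M : (M i <= p ^ (n * e))%N.
    apply: leq_trans (leq_bigmax i) _; apply: leq_trans (leq_addl N _) _.
    apply: leq_trans (leq_pmulr n e_gt0) (ltnW (ltn_expl _ _)).
    exact: prime_gt1 (pcharf_prime hp).
  rewrite exprMn mulrC -(subnK le_M) addnC exprD -mulrA.
  by apply: idealMr.
have [m [s sP]] := dual_basis_iter n hom Dphi.
have : X (c ^+ m * d).
  rewrite sP; apply: ideal_sum_closed => // w; apply: idealMr => //; apply: XI.
  by apply: (stable n); apply: imI; exists w.2; rewrite mulrC.
move=> /Xd[m' [f [m'' [r eqf]] eqd]]; exists N, (m'' + (m' + m))%N, r.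
rewrite -eqf exprD; congr (_ * _); apply: (nzd_inj nzd_d).
by rewrite exprD [RHS]mulrC -eqd mulrC mulrA.
Qed.

Lemma dual_basis_image e phi c :
  cartier_hom hp e phi -> dual_basis p e phi c -> exists z, c = phi z.
Proof.
move=> hom [s sP].
suff [r] : [set y | exists r, y = phi (1 * r)] c by exists (1 * r).
have idim := cartier_image_ideal 1 hom.
rewrite -[c]mulr1 sP; apply: ideal_sum_closed => // w; apply: idealMr => //.
rewrite -(prednK (pexp_gt0 hp e)) exprS; apply: idealMr => //.
by exists w.2; rewrite mulrC.
Qed.

Lemma power_image_mul e phi c z m k d x : (0 < e)%N -> cartier_hom hp e phi ->
  c ^+ m = phi z -> c ^+ k = d * x ->
  exists r, c ^+ (uphalf k + m) = phi (d * r).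
Proof.
move=> e_gt0 hom eqm eqk.
have le_k : (k <= uphalf k * p ^ e)%N.
  apply: leq_trans (leq_mul (leqnn (uphalf k)) (pexp_gt1 hp e_gt0)); lia.
exists (x * c ^+ (uphalf k * p ^ e - k) * z).
rewrite exprD eqm (cartierZ _ _ hom) -exprM -{1}(subnKC le_k) exprD eqk.
by rewrite !mulrA.
Qed.

(** The exponent depends on [m] only: applying [phi] once more turns [c^k] into
    [c^(k / p^e + m)], roughly, and this makes [k] drop as long as [k] is larger
    than [2 m + 1]. *)
Lemma iterated_image_power_bound e phi c z m k n d x : (0 < e)%N ->
  cartier_hom hp e phi -> c ^+ m = phi z -> c ^+ k = iter n phi (d * x) ->
  exists n' r, c ^+ m.*2.+1 = iter n' phi (d * r).
Proof.
move=> e_gt0 hom eqm; elim/ltn_ind: k n x => k IHk n x eqk.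
have [le_k | lt_k] := leqP k m.*2.+1.
  exists n, (c ^+ (m.*2.+1 - k) ^+ (p ^ (n * e)) * x).
  rewrite mulrCA -(cartierZ _ _ (cartier_iter (n := n) hom)) -eqk.
  by rewrite -exprD subnK.
have [|r eqr] := power_image_mul (k := k) (d := iter n phi (d * x)) (x := 1) e_gt0 hom eqm.
  by rewrite mulr1; exact: eqk.
have lt_k' : (uphalf k + m < k)%N by lia.
apply: (IHk _ lt_k' n.+1 (x * r ^+ (p ^ (n * e)))).
rewrite eqr /= mulrC (cartierZ _ _ (cartier_iter (n := n) hom)).
by congr (phi (iter n phi _)); ring.
Qed.

Lemma square_in_iterated_image e phi c n : (0 < e)%N ->
  cartier_hom hp e phi -> dual_basis p e phi c ->
  exists z, c ^+ 2 = iter n phi z.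
Proof.
move=> e_gt0 hom /(dual_basis_image hom)[z0 eqz0].
elim: n => [|n [z eqz]]; first by exists (c ^+ 2).
have [|r ->] := power_image_mul (m := 1) (k := 2) (d := iter n phi z) (x := 1) e_gt0 hom eqz0.
  by rewrite mulr1.
by exists (r ^+ (p ^ (n * e)) * z); rewrite /= -(cartierZ _ _ (cartier_iter (n := n) hom)) mulrC.
Qed.

(** The exponent is the same for all [n], because [c^2] is a value of
    [psi o phi^n] for every [n]: the dual bases give [c] as a value of [phi] and
    of [psi], and [c^2] as a value of [phi^n] goes on to [c^(2/q) c] under [psi],
    rounded up. *)
Lemma uniform_iterated_image e e' phi psi c n d : (0 < e)%N -> (0 < e')%N ->
  cartier_hom hp e phi -> cartier_hom hp e' psi ->
  dual_basis p e phi c -> dual_basis p e' psi c -> nzd c -> nzd d ->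
  exists k r, c ^+ 5 = iter k (psi \o iter n phi) (d * r).
Proof.
move=> e_gt0 e'_gt0 hphi hpsi Dphi Dpsi nzd_c nzd_d.
have homn := cartier_iter (n := n) hphi.
have homPhi := cartier_comp hpsi homn.
have deg_gt0 : (0 < e' + n * e)%N by rewrite addn_gt0 e'_gt0.
have [z eqz] : exists z, c ^+ 2 = (psi \o iter n phi) z.
  have [z0 eqz0] := dual_basis_image hpsi Dpsi.
  have [z1 eqz1] := square_in_iterated_image n e_gt0 hphi Dphi.
  have [|r eqr] := power_image_mul (m := 1) (k := 2) (d := iter n phi z1) (x := 1) e'_gt0 hpsi eqz0.
    by rewrite mulr1.
  exists (r ^+ (p ^ (n * e)) * z1).
  by rewrite eqr /= -(cartierZ _ _ homn) mulrC.
have [M DPhi] : exists M, dual_basis p (e' + n * e) (psi \o iter n phi) (c ^+ M).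
  have [m Dn] := dual_basis_iter n hphi Dphi.
  exists (p ^ (n * e) + m)%N; rewrite exprD; exact: dual_basis_comp homn Dpsi Dn.
have [k [m [r eqr]]] :=
  iterated_image_has_power deg_gt0 homPhi DPhi (nzdX (n := M) nzd_c) nzd_d.
rewrite -exprM in eqr.
exact: (iterated_image_power_bound deg_gt0 homPhi eqz eqr).
Qed.

End IteratedImages.

(** * Non-degenerate maps and the subalgebras that they generate *)

Section CyclicSubalgebra.
Variables (R : comNzRingType) (p : nat) (hp : p \in [pchar R]).
Implicit Types (phi psi : R -> R) (T : nat -> set (R -> R)).

Definition cyclic_subalgebra phi (d e : nat) : set (R -> R) :=
  [set psi | psi = 0 \/
     exists n x, e = (n * d)%N /\ psi = premul (iter n phi) x].

(** If no value of [phi] is a nonzerodivisor, some [z <> 0] annihilates the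
    image of [phi], and then [phi] becomes zero at the minimal prime [ann (z y)],
    for a suitable [y]. *)
Lemma nondegenerate_eltP e phi : reduced_ring R -> noetherian_ring R ->
  cartier_hom hp e phi ->
  nondegenerate_elt p e phi <-> exists y, nzd (phi y).
Proof.
move=> redR noethR hom; split=> [ndphi | [y nzd_y] eta mineta]; last first.
  have [_ eta1 _] := mineta.1.
  exists (y, 1); split=> //; rewrite /loc_eq /loc_map /=.
  case=> w eta_w; rewrite expr1n !mul1r mulr1 mul0r subr0 mulrC => /nzd_y w0.
  by apply: eta_w; rewrite w0; case: mineta => -[[]].
suff [_ [y ->] nzd_y] : exists2 z, (exists y, z = phi (1 * y)) & nzd z.
  by exists (1 * y).
apply: faithful_ideal_has_nzd => //; first exact: cartier_image_ideal hom.
move=> z zphi; apply: contrapT => z0.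
have [y [zy0 min]] := minimal_prime_avoiding redR noethR z0.
have [[x s] /= [_ nloc]] := ndphi _ min; apply: nloc.
exists (z * y) => /=.
  move=> zyzy; apply: zy0; apply: (redR _ 2%N); exact: zyzy.
rewrite mulr1 mul0r subr0 mulrAC zphi ?mul0r //.
by exists (s ^+ (p ^ e - 1) * x); rewrite mul1r.
Qed.

Lemma nzd_image_comp d e phi psi y z :
  cartier_hom hp d phi -> cartier_hom hp e psi ->
  nzd (phi y) -> nzd (psi z) -> exists x, nzd ((phi \o psi) x).
Proof.
move=> hphi hpsi nphi npsi.
exists ((psi z ^+ (p ^ d).-1 * y) ^+ (p ^ e) * z) => /=.
rewrite -(cartierZ _ _ hpsi) mulrAC -exprSr (prednK (pexp_gt0 hp d)).
by rewrite -(cartierZ _ _ hphi); apply: nzdM.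
Qed.

Lemma nzd_image_iter e phi y n : cartier_hom hp e phi ->
  nzd (phi y) -> exists x, nzd (iter n phi x).
Proof.
move=> hom nphi; elim: n => [|n [x nx]]; first by exists 1; apply: nzd1.
exact: nzd_image_comp hom (cartier_iter hom) nphi nx.
Qed.

Lemma premul_inj e phi y : reduced_ring R -> cartier_hom hp e phi ->
  nzd (phi y) -> injective (premul phi).
Proof.
move=> redR hom nphi x x' eqx; apply/eqP; rewrite -subr_eq0; apply/eqP.
apply: nphi; rewrite mulrC (cartierZ _ _ hom) -(prednK (pexp_gt0 hp e)).
set u := x - x'; rewrite exprS -mulrA mulrBl (cartierB _ _ hom).
by have := congr1 (fun f => f (u ^+ (p ^ e).-1 * y)) eqx; rewrite /premul => ->; rewrite subrr.
Qed.

Lemma cyclic_subalgebra_sub phi d T : graded_subalgebra hp T ->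
  T 0%N = cartier_hom hp 0 -> T d phi ->
  forall e, cyclic_subalgebra phi d e `<=` T e.
Proof.
move=> [Tadd [Tid Tcomp]] T0 Tphi e psi [->|[n [x [-> ->]]]].
  by case: (Tadd e).
have Tx : T 0%N (fun y => x * y).
  rewrite T0; apply/cartier_homP; split=> [y z|r y]; first by rewrite mulrDr.
  by rewrite expr1 mulrCA.
suff Tn : T (n * d)%N (iter n phi).
  by rewrite -[(n * d)%N]addn0; apply: Tcomp Tn Tx.
elim: n => [|n IHn]; first exact: Tid.
by rewrite mulSn; apply: Tcomp Tphi IHn.
Qed.

Lemma cyclic_subalgebra_premul phi d n x :
  cyclic_subalgebra phi d (n * d) (premul (iter n phi) x).
Proof. by right; exists n, x. Qed.

Lemma cyclic_subalgebra_iter phi d n :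
  cyclic_subalgebra phi d (n * d) (iter n phi).
Proof.
right; exists n, 1; split=> //.
by apply/funext => y; rewrite /premul mul1r.
Qed.

Section Structure.
Variables (d : nat) (phi : R -> R).
Hypotheses (d_gt0 : (0 < d)%N) (hom : cartier_hom hp d phi).
Let T := cyclic_subalgebra phi d.

Lemma cyclic_subalgebra_cartier e : T e `<=` cartier_hom hp e.
Proof.
move=> psi [->|[n [x [-> ->]]]]; last exact: cartier_premul (cartier_iter hom).
apply/cartier_homP; split=> *; rewrite /GRing.zero /=.
  by rewrite addr0.
by rewrite mulr0.
Qed.

Lemma cyclic_subalgebra_graded : graded_subalgebra hp T.
Proof.
split; last split.
- move=> e; split; first exact: cyclic_subalgebra_cartier.
  + by left.
  + move=> f g [->|[n [x [en ->]]]] Tg; first by rewrite add0r.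
    case: Tg => [->|[m [y [em ->]]]].
      by rewrite addr0; right; exists n, x.
    right; exists n, (x + y); split=> //.
    have -> : m = n by apply/eqP; rewrite -(eqn_pmul2r d_gt0) -em en.
    apply/funext => z; rewrite /premul mulrDl.
    by rewrite (cartierD _ _ (cartier_iter hom)).
  + move=> f [->|[n [x [en ->]]]]; first by left; rewrite oppr0.
    right; exists n, (- x); split=> //; apply/funext => z; rewrite /premul mulNr.
    rewrite -[- (x * z)]sub0r (cartierB _ _ (cartier_iter hom)) (cartier0 (cartier_iter hom)).
    by rewrite sub0r.
- exact: (cyclic_subalgebra_iter phi d 0).
- move=> e e' f g [->|[n [x [-> ->]]]]; first by left.
  case=> [->|[m [y [-> ->]]]].
    left; apply/funext => z; rewrite /= /premul [X in _ * X]/(0 : R).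
    by rewrite mulr0 (cartier0 (cartier_iter hom)).
  right; exists (n + m)%N, (x ^+ (p ^ (m * d)) * y); split; first by rewrite mulnDl.
  apply/funext => z; rewrite /= /premul (cartierZ _ _ (cartier_iter hom)).
  by rewrite iterD mulrA.
Qed.

Lemma cyclic_subalgebra0 : T 0%N = cartier_hom hp 0.
Proof.
rewrite eqEsubset; split; first exact: cyclic_subalgebra_cartier.
move=> psi /cartier_homP[_ psiZ]; right; exists 0%N, (psi 1); split=> //.
apply/funext => x; rewrite /premul /=.
by have := psiZ x 1; rewrite expr1 mulr1 mulrC.
Qed.

Hypothesis redR : reduced_ring R.
Variable y : R.
Hypothesis nphi : nzd (phi y).

Lemma cyclic_subalgebra_free : free_of_rank_one T d.
Proof.
exists (premul phi); split.
- by move=> x z; apply/funext => u; rewrite /premul mulrDl (cartierD _ _ hom).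
- by move=> x z; apply/funext => u; rewrite /premul mulrCA mulrA.
- exact: premul_inj redR hom nphi.
- rewrite eqEsubset; split.
    move=> _ [x _ <-]; right; exists 1%N, x; by rewrite mul1n.
  move=> psi [->|[n [x [/eqP]]]].
    by exists 0 => //; apply/funext => z; rewrite /premul mul0r (cartier0 hom).
  rewrite -{1}[d]mul1n eqn_pmul2r // => /eqP <- ->.
  by exists x.
Qed.

Lemma tensor_comp_cat (s s' : seq ((R -> R) * (R -> R))) :
  tensor_comp (s ++ s') = tensor_comp s + tensor_comp s'.
Proof. by rewrite /tensor_comp big_cat. Qed.

Lemma tensor_comp1 (f g : R -> R) : tensor_comp [:: (f, g)] = f \o g.
Proof. by rewrite /tensor_comp big_seq1. Qed.

Lemma tensor_comp_eq (e e' : nat) s s' :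
  tensor_eq (@premul R) (@postmul R) (T e) (T e') s s' ->
  tensor_comp s = tensor_comp s'.
Proof.
elim=> {s s'} //.
- by move=> s s' s'' _ -> _ ->.
- by move=> s1 s1' s2 s2' _ eq1 _ eq2; rewrite !tensor_comp_cat eq1 eq2.
- by move=> u v; rewrite /tensor_comp !big_cons !big_nil addrCA.
- by move=> n Tn; rewrite tensor_comp1 /tensor_comp big_nil.
- move=> m /cyclic_subalgebra_cartier hm; rewrite tensor_comp1 /tensor_comp big_nil.
  by apply/funext => x; exact: (cartier0 hm).
- by move=> m m' n *; rewrite /tensor_comp !big_cons !big_nil !addr0.
- move=> m n n' /cyclic_subalgebra_cartier hm *.
  rewrite /tensor_comp !big_cons !big_nil !addr0.
  by apply/funext => x; exact: (cartierD _ _ hm).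
- by move=> m a n *; rewrite !tensor_comp1.
Qed.

(** Every tensor equals a pure one with left factor [phi^n], and composition
    with [phi^n] is injective on maps in [Hom(F^r_* R, R)]. *)
Lemma cyclic_subalgebra_comp n r : comp_isomorphism T (n * d) r.
Proof.
have [Tadd [Tid Tcomp]] := cyclic_subalgebra_graded.
have homn := cartier_iter (n := n) hom.
have Tn : T (n * d)%N (iter n phi) := cyclic_subalgebra_iter phi d n.
have Tpost x psi : T r psi -> T r (postmul x psi).
  move=> Tpsi; rewrite -[r]add0n; apply: (Tcomp _ _ (premul id x) psi) => //.
  exact: (cyclic_subalgebra_premul phi d 0).
have compT s : formal_tensor (T (n * d)%N) (T r) s ->
    T (n * d + r)%N (tensor_comp s).
  elim: s => [|q s IHs] /=; first by rewrite /tensor_comp big_nil; case: (Tadd (n * d + r)%N).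
  case=> Tq1 Tq2 /IHs Ts; rewrite /tensor_comp big_cons.
  by case: (Tadd (n * d + r)%N) => _ _ TD _; apply: TD => //; apply: Tcomp.
pose teq := tensor_eq (@premul R) (@postmul R) (T (n * d)%N) (T r).
have normal s : formal_tensor (T (n * d)%N) (T r) s ->
    exists psi, T r psi /\ teq s [:: (iter n phi, psi)].
  elim: s => [_|[f psi] s IHs /= [Tf Tpsi /IHs[chi [Tchi eqs]]]].
    exists 0; split; first by case: (Tadd r).
    by apply: tensor_sym; apply: tensor_0r.
  have [x eqf] : exists x, f = premul (iter n phi) x.
    case: Tf => [->|[m [x [/eqP]]]].
      by exists 0; apply/funext => z; rewrite /premul mul0r (cartier0 homn).
    by rewrite eqn_pmul2r // => /eqP <- ->; exists x.
  exists (postmul x psi + chi); split.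
    by case: (Tadd r) => _ _ TD _; apply: TD => //; apply: Tpost.
  apply: tensor_trans; last by apply: tensor_sym; apply: tensor_Dr => //; apply: Tpost.
  apply: (@tensor_cat _ _ _ _ _ _ _ [:: (f, psi)] [:: (iter n phi, postmul x psi)]) => //.
  by rewrite eqf; apply: tensor_bal.
have [z nz] := nzd_image_iter n hom nphi.
split.
- move=> s s' /normal[psi [Tpsi eqs]] /normal[psi' [Tpsi' eqs']]; split.
    exact: tensor_comp_eq.
  rewrite (tensor_comp_eq eqs) (tensor_comp_eq eqs') !tensor_comp1 => eqpsi.
  suff eqP : psi = psi' by rewrite eqP in eqs; apply: tensor_trans eqs (tensor_sym eqs').
  have hpsi := cyclic_subalgebra_cartier Tpsi.
  have hpsi' := cyclic_subalgebra_cartier Tpsi'.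
  apply/funext => x; apply: (premul_inj redR homn nz); apply/funext => u.
  have := congr1 (fun f => f (u ^+ (p ^ r) * x)) eqpsi.
  by rewrite /premul /= -(cartierZ _ _ hpsi) -(cartierZ _ _ hpsi') ![u * _]mulrC.
- move=> chi; split; last by case=> s /compT Ts ->.
  case=> [->|[k [x [eqk ->]]]]; first by exists [::]; rewrite // /tensor_comp big_nil.
  have le_nk : (n <= k)%N by rewrite -(leq_pmul2r d_gt0) -eqk leq_addr.
  exists [:: (iter n phi, premul (iter (k - n) phi) x)].
    split=> //; right; exists (k - n)%N, x; split=> //.
    by rewrite mulnBl -eqk addKn.
  by rewrite tensor_comp1 -{1}(subnKC le_nk); apply/funext => u; rewrite /premul /= iterD.
- by move=> *; apply: tensor_comp_cat.
- move=> s u _; rewrite /tensor_comp /tensor_premul big_map.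
  apply/funext => x; rewrite /premul !fct_sumE.
  by apply: eq_bigr => q _.
Qed.

End Structure.
End CyclicSubalgebra.

(** * Powers of an ideal and test exponents *)

Section TestExponents.
Variables (R : comNzRingType) (a : set R).

Lemma ideal_exp_ideal n : is_ideal (ideal_exp a n).
Proof. by case: n => [|n]; [split | apply: ideal_gen_ideal]. Qed.

Lemma ideal_expD m n u v : ideal_exp a m u -> ideal_exp a n v ->
  ideal_exp a (m + n) (u * v).
Proof.
move=> au av; elim: m u au => [|m IHm] u au.
  by case: (ideal_exp_ideal n) => _ _; apply.
have idD := ideal_exp_ideal (m.+1 + n).
apply: (ideal_gen_sub (I := [set u | ideal_exp a (m.+1 + n) (u * v)])) au.
  have [D0 DD DM] := idD; split=> [|x y|r x] /=; first by rewrite mul0r.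
    by rewrite mulrDl; apply: DD.
  by rewrite -mulrA; apply: DM.
move=> _ [x [y [ax ay ->]]] /=; apply: sub_ideal_gen.
by exists x, (y * v); split=> //; [exact: IHm | rewrite mulrA].
Qed.

Lemma ideal_exp_le m n : (m <= n)%N -> ideal_exp a n `<=` ideal_exp a m.
Proof.
move/subnK <-; elim: (n - m)%N => // k IHk; apply: subset_trans IHk.
apply: ideal_gen_sub; first exact: ideal_exp_ideal.
by move=> _ [x [y [_ ay ->]]]; case: (ideal_exp_ideal (k + m)) => _ _; apply.
Qed.

Lemma ideal_exp_gen n u : a u -> ideal_exp a n (u ^+ n).
Proof.
move=> au; elim: n => // n IHn; rewrite exprS.
by apply: sub_ideal_gen; exists u, (u ^+ n).
Qed.

Lemma ideal_expX m n u : ideal_exp a m u -> ideal_exp a (n * m) (u ^+ n).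
Proof.
move=> au; elim: n => // n IHn; rewrite exprS mulSn.
exact: ideal_expD.
Qed.

Variables (K : realType) (t : K) (p : nat).
Hypotheses (t_gt0 : 0 < t) (p_gt0 : (0 < p)%N).

Lemma absz_ceil_ge (x : K) : x <= `|Num.ceil x|%N%:R.
Proof.
apply: le_trans (ceil_ge x) _.
by rewrite -[leRHS]/((`|Num.ceil x|%N : int)%:~R) ler_int lez_abs.
Qed.

Lemma absz_ceil_le (x : K) n : 0 <= x -> x <= n%:R -> (`|Num.ceil x| <= n)%N.
Proof.
move=> x_ge0 le_xn; rewrite -lez_nat gez0_abs; last first.
  by rewrite -(ler_int K) (le_trans x_ge0) ?ceil_ge.
by rewrite ceil_le_int.
Qed.

Lemma test_exponent_arg_ge0 e : 0 <= t * (p ^ e - 1)%:R.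
Proof. by rewrite mulr_ge0 // ?ler0n // ltW. Qed.

Lemma test_exponent0 : test_exponent t p 0 = 0%N.
Proof. by apply/eqP; rewrite -leqn0 absz_ceil_le // subnn mulr0. Qed.

Lemma test_exponentD d e : (test_exponent t p (d + e) <=
  p ^ e * test_exponent t p d + test_exponent t p e)%N.
Proof.
apply: absz_ceil_le; first exact: test_exponent_arg_ge0.
rewrite natrD natrM.
apply: le_trans (lerD (ler_wpM2l (ler0n _ _) (absz_ceil_ge (t * (p ^ d - 1)%:R)))
  (absz_ceil_ge (t * (p ^ e - 1)%:R))).
have posp k : (0 < p ^ k)%N by rewrite expn_gt0 p_gt0.
rewrite !natrB ?posp // expnD natrM.
rewrite le_eqVlt; apply/orP; left; apply/eqP; ring.
Qed.

Lemma test_exponent_le e : (test_exponent t p e <= `|Num.ceil t| * p ^ e)%N.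
Proof.
apply: absz_ceil_le; first exact: test_exponent_arg_ge0.
rewrite natrM; apply: ler_pM => //; first exact: ltW.
  exact: absz_ceil_ge.
by rewrite ler_nat leq_subr.
Qed.

End TestExponents.

(** * Test ideals *)

Section TestIdeals.
Variables (R : comNzRingType) (p : nat) (hp : p \in [pchar R]).
Variables (a : set R) (K : realType) (t : K).
Hypothesis t_gt0 : 0 < t.
Implicit Types (T : nat -> set (R -> R)) (phi psi : R -> R) (J L : set R).

Lemma compatible_idealP T J : (forall e, T e `<=` cartier_hom hp e) ->
  compatible_ideal p T a t J <->
  [/\ is_ideal J, J `&` @Rcirc R !=set0 & forall e phi u v, T e phi ->
    ideal_exp a (test_exponent t p e) u -> J v -> J (phi (u * v))].
Proof.
move=> Thom; split=> -[idJ JR JT]; split=> // e phi.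
  move=> u v Tphi au Jv; apply: (JT _ _ Tphi); exists (u * v) => //.
  by apply: sub_ideal_gen; exists u, v.
move=> Tphi; apply: (image_ideal_mul_sub (Thom _ _ Tphi)) => //.
  exact: ideal_exp_ideal.
by move=> u v; apply: JT.
Qed.

Lemma compatible_ideal_sub T T' J : (forall e, T' e `<=` T e) ->
  compatible_ideal p T a t J -> compatible_ideal p T' a t J.
Proof. by move=> sub [idJ JR JT]; split=> // e phi /sub; apply: JT. Qed.

Definition test_ideal T : set R :=
  [set x | forall J, compatible_ideal p T a t J -> J x].

Lemma test_ideal_ideal T : is_ideal (test_ideal T).
Proof.
split=> [J [[]] // | x y Jx Jy J cJ | r x Jx J cJ].
  by case: (cJ) => -[_ JD _] _ _; apply: JD; [apply: Jx | apply: Jy].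
by case: (cJ) => -[_ _ JM] _ _; apply: JM; apply: Jx.
Qed.

Lemma is_big_test_idealP T b : (forall e, T e `<=` cartier_hom hp e) ->
  @Rcirc R b -> test_ideal T b ->
  is_big_test_ideal p T a t (test_ideal T).
Proof.
move=> Thom Rb Tb; split; last by move=> J cJ x; apply.
apply/compatible_idealP => //; split; first exact: test_ideal_ideal.
  by exists b.
move=> e phi u v Tphi au Tv J cJ; have [_ _ JT] := (compatible_idealP J Thom).1 cJ.
by apply: JT au _ => //; apply: Tv.
Qed.

Lemma test_ideal_cyclic_image phi d n u v : cartier_hom hp d phi ->
  ideal_exp a (test_exponent t p (n * d)) u ->
  test_ideal (cyclic_subalgebra phi d) v ->
  test_ideal (cyclic_subalgebra phi d) (iter n phi (u * v)).
Proof.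
move=> hom au Tv J cJ.
have [_ _ JT] := (compatible_idealP J (cyclic_subalgebra_cartier hom)).1 cJ.
by apply: JT au _; [apply: cyclic_subalgebra_iter | apply: Tv].
Qed.

(** The smallest ideal containing [b] and stable under the maps [phi^n] twisted
    by [a]. *)
Definition twisted_orbit phi d b : set R :=
  ideal_gen [set x | exists n u,
    ideal_exp a (test_exponent t p (n * d)) u /\ x = iter n phi (u * b)].

Lemma test_exponent_twist d e u v :
  ideal_exp a (test_exponent t p d) u -> ideal_exp a (test_exponent t p e) v ->
  ideal_exp a (test_exponent t p (d + e)) (u ^+ (p ^ e) * v).
Proof.
move=> au av; have p_gt0 := prime_gt0 (pcharf_prime hp).
apply: (ideal_exp_le (test_exponentD t_gt0 p_gt0 d e)).
by apply: ideal_expD => //; apply: ideal_expX.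
Qed.

Lemma test_ideal_sub_orbit phi d b : cartier_hom hp d phi -> @Rcirc R b ->
  test_ideal (cyclic_subalgebra phi d) `<=` twisted_orbit phi d b.
Proof.
move=> hom Rb x; apply.
have idO : is_ideal (twisted_orbit phi d b) by apply: ideal_gen_ideal.
apply/(compatible_idealP _ (cyclic_subalgebra_cartier hom)); split=> //.
  exists b; split=> //; apply: sub_ideal_gen; exists 0%N, 1.
  by rewrite mul1r mul0n test_exponent0.
move=> e psi u v [->|[n [z [-> ->]]]] au; first by move=> _; case: idO.
have homn := cartier_iter (n := n) hom.
pose L : set R := [set v | forall w, ideal_exp a (test_exponent t p (n * d)) w ->
  twisted_orbit phi d b (iter n phi (w * v))].
suff LO : twisted_orbit phi d b `<=` L.
  move=> /LO Lv; rewrite /premul mulrA; apply: Lv.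
  by case: (ideal_exp_ideal a (test_exponent t p (n * d))) => _ _; apply.
apply: ideal_gen_sub.
  have [O0 OD OM] := idO; split=> [w _ | v1 v2 L1 L2 w aw | r v1 L1 w aw].
  - by rewrite mulr0 (cartier0 homn).
  - by rewrite mulrDr (cartierD _ _ homn); apply: OD; [apply: L1 | apply: L2].
  - rewrite mulrA; apply: L1; rewrite mulrC.
    by case: (ideal_exp_ideal a (test_exponent t p (n * d))) => _ _; apply.
move=> _ [m [w' [aw' ->]]] w aw; apply: sub_ideal_gen.
exists (n + m)%N, (w ^+ (p ^ (m * d)) * w'); split.
  by rewrite mulnDl; apply: test_exponent_twist.
by rewrite (cartierZ _ _ (cartier_iter hom)) iterD mulrA.
Qed.

Hypotheses (redR : reduced_ring R) (noethR : noetherian_ring R).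
Hypotheses (finR : F_finite hp) (aR : a `&` @Rcirc R !=set0).

(** If [al] in [a] is a nonzerodivisor, the twist by [a] is made up for by a
    fixed power of [al], since [al^(ceil t p^e)] lies in the power of [a] that
    goes with the maps of degree [e]. *)
Lemma uniform_test_element e e' phi psi y z : (0 < e)%N -> (0 < e')%N ->
  cartier_hom hp e phi -> cartier_hom hp e' psi -> nzd (phi y) -> nzd (psi z) ->
  exists2 b, nzd b & forall n,
    test_ideal (cyclic_subalgebra (psi \o iter n phi) (e' + n * e)) b.
Proof.
move=> e_gt0 e'_gt0 hphi hpsi nphi npsi.
have [al [a_al /(Rcirc_nzd redR noethR) nzd_al]] := aR.
have [c1 nzd_c1 D1] := exists_dual_basis redR noethR finR hphi nphi.
have [c2 nzd_c2 D2] := exists_dual_basis redR noethR finR hpsi npsi.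
have nzd_c := nzdM nzd_c1 nzd_c2; set c := c1 * c2 in nzd_c.
have Dphi : dual_basis p e phi c by rewrite /c mulrC; apply: dual_basis_mul.
have Dpsi : dual_basis p e' psi c by apply: dual_basis_mul.
pose s := `|Num.ceil t|%N.
exists (al ^+ s * c ^+ 5); first by apply: nzdM; apply: nzdX.
move=> n J cJ; set Phi := psi \o iter n phi; set E := (e' + n * e)%N.
have homPhi : cartier_hom hp E Phi.
  exact: cartier_comp hpsi (cartier_iter hphi).
have [idJ [d [Jd /(Rcirc_nzd redR noethR) nzd_d]] JT] :=
  (compatible_idealP J (cyclic_subalgebra_cartier homPhi)).1 cJ.
have [k [r eqr]] := uniform_iterated_image noethR n e_gt0 e'_gt0 hphi hpsi
  Dphi Dpsi nzd_c nzd_d.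
rewrite eqr -/Phi (cartierZ _ _ (cartier_iter homPhi)) -exprM.
apply: (JT (k * E)%N); [exact: cyclic_subalgebra_iter | | exact: idealMr].
apply: ideal_exp_le; last exact: ideal_exp_gen.
by apply: test_exponent_le => //; apply: prime_gt0 (pcharf_prime hp).
Qed.

Lemma cyclic_test_element e phi y : (0 < e)%N -> cartier_hom hp e phi ->
  nzd (phi y) -> exists2 b, @Rcirc R b & test_ideal (cyclic_subalgebra phi e) b.
Proof.
move=> e_gt0 hom nphi.
have [b nzd_b /(_ 0%N)] := uniform_test_element e_gt0 e_gt0 hom hom nphi nphi.
rewrite mul0n addn0; exists b => //; exact/Rcirc_nzd.
Qed.

(** Let [b] be a common test element of all [psi o phi^n].  The test ideal of
    [phi] lies in the sum of the [phi^n (a^[..] b)], which [psi] maps into the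
    sum of the [psi o phi^n (a^[..] b)]. *)
Lemma test_ideal_image e e' phi psi y z L u x : (0 < e)%N -> (0 < e')%N ->
  cartier_hom hp e phi -> cartier_hom hp e' psi -> nzd (phi y) -> nzd (psi z) ->
  is_ideal L ->
  (forall n, test_ideal (cyclic_subalgebra (psi \o iter n phi) (e' + n * e)) `<=` L) ->
  ideal_exp a (test_exponent t p e') u ->
  test_ideal (cyclic_subalgebra phi e) x -> L (psi (u * x)).
Proof.
move=> e_gt0 e'_gt0 hphi hpsi nphi npsi idL subL au.
have [b nzd_b bP] := uniform_test_element e_gt0 e'_gt0 hphi hpsi nphi npsi.
have Rb : @Rcirc R b by apply/Rcirc_nzd.
move=> /(test_ideal_sub_orbit hphi Rb).
pose M : set R := [set x | forall u, ideal_exp a (test_exponent t p e') u ->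
  L (psi (u * x))].
suff OM : twisted_orbit phi e b `<=` M by move=> /OM; apply.
apply: ideal_gen_sub.
  have [L0 LD LM] := idL; split=> [w _ | v1 v2 L1 L2 w aw | r v1 L1 w aw].
  - by rewrite mulr0 (cartier0 hpsi).
  - by rewrite mulrDr (cartierD _ _ hpsi); apply: LD; [apply: L1 | apply: L2].
  - rewrite mulrA; apply: L1; rewrite mulrC.
    by case: (ideal_exp_ideal a (test_exponent t p e')) => _ _; apply.
move=> _ [n [v [av ->]]] w aw; apply: (subL n).
have homn := cartier_iter (n := n) hphi.
rewrite (cartierZ _ _ homn) mulrA.
apply: (test_ideal_cyclic_image (n := 1) (cartier_comp hpsi homn)) (bP n).
by rewrite mul1n; apply: test_exponent_twist.
Qed.

End TestIdeals.

Lemma ideal_sum_ideal (R : comNzRingType) n (J : 'I_n -> set R) :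
  (forall i, is_ideal (J i)) -> is_ideal (ideal_sum J).
Proof.
move=> idJ; split.
- by exists (fun _ => 0); split=> [i|]; [case: (idJ i) | rewrite big1].
- move=> _ _ [y [Jy ->]] [z [Jz ->]]; exists (fun i => y i + z i).
  by split=> [i|]; [case: (idJ i) => _ JD _; apply: JD | rewrite big_split].
- move=> r _ [y [Jy ->]]; exists (fun i => r * y i).
  by split=> [i|]; [case: (idJ i) => _ _; apply | rewrite mulr_sumr].
Qed.

Unset Implicit Arguments.

Theorem theorem5p1 (R : comNzRingType) (p : nat) (hp : p \in [pchar R])
    (T : nat -> set (R -> R)) (a : set R) (K : realType) (t : K)
    (noethR : noetherian_ring R)
    (triple : cartier_triple hp T a t)
    (nondeg : nondegenerate_triple p T a)
    (gen : nondegenerately_generated p T a) :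
  exists (n : nat) (Ti : 'I_n -> nat -> set (R -> R)),
    (forall i, [/\ graded_subalgebra hp (Ti i),
        (forall e, Ti i e `<=` T e),
        cartier_triple hp (Ti i) a t
      & pseudo_Q_Gorenstein p (Ti i) a]) /\
    exists (tau : set R) (taui : 'I_n -> set R),
      [/\ is_big_test_ideal p T a t tau,
          (forall i, is_big_test_ideal p (Ti i) a t (taui i))
        & tau = ideal_sum taui].
Proof.
have [[redR finR gradT T0] ida t_gt0] := triple.
have [genT aR] := gen.
have Thom e : T e `<=` cartier_hom hp e by case: gradT => /(_ e)[].
pose alg (w : (R -> R) * nat) := cyclic_subalgebra w.1 w.2.
pose tau w : set R := test_ideal p a t (alg w).
pose good (w : (R -> R) * nat) :=
  [/\ (0 < w.2)%N, T w.2 w.1 & exists y, nzd (w.1 y)].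
have good_elt e phi : (0 < e)%N -> T e phi -> nondegenerate_elt p e phi ->
    good (phi, e).
  move=> e_gt0 Tphi ndphi; split=> //.
  exact: (nondegenerate_eltP redR noethR (Thom _ _ Tphi)).1.
have sub_alg w : good w -> forall e, alg w e `<=` T e.
  by case=> _ Tw _; apply: cyclic_subalgebra_sub gradT T0 Tw.
have tau_b w : good w -> exists2 b, @Rcirc R b & tau w b.
  case=> w_gt0 /Thom hw [y nw].
  exact: (cyclic_test_element t_gt0 redR noethR finR aR w_gt0 hw nw).
have idtau w : is_ideal (tau w) by apply: test_ideal_ideal.
(* by maximality, one of these finite sums contains every tau w *)
pose sums : set (set R) := [set S | exists n (F : 'I_n -> (R -> R) * nat),
  (forall i, good (F i)) /\ S = ideal_sum (fun i => tau (F i))].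
have [||S [[n [F [goodF defS]]] Smax]] := maximal_ideal_in noethR (P := sums).
- by exists (ideal_sum (fun i : 'I_0 => tau (0, 0%N))), 0%N, (fun=> (0, 0%N)); split=> // -[].
- by move=> _ [n [F [_ ->]]]; apply: ideal_sum_ideal.
have idS : is_ideal S by rewrite defS; apply: ideal_sum_ideal.
have tauS w : good w -> tau w `<=` S.
  move=> goodw x taux.
  pose F' (i : 'I_n.+1) := if unlift ord0 i is Some j then F j else w.
  have F'0 : F' ord0 = w by rewrite /F' unlift_none.
  have F'S j : F' (lift ord0 j) = F j by rewrite /F' liftK.
  apply: (Smax (ideal_sum (fun i => tau (F' i)))).
  - exists n.+1, F'; split=> // i.
    by case: (unliftP ord0 i) => [j ->|->]; rewrite ?F'S ?F'0.
  - rewrite defS => _ [y [Fy ->]].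
    exists (fun i => if unlift ord0 i is Some j then y j else 0); split=> [i|].
      case: (unliftP ord0 i) => [j ->|->]; first by rewrite F'S; apply: Fy.
      by case: (idtau (F' ord0)).
    rewrite big_ord_recl unlift_none add0r.
    by apply: eq_bigr => j _; rewrite liftK.
  - exists (fun i => if unlift ord0 i is Some j then 0 else x); split=> [i|].
      case: (unliftP ord0 i) => [j ->|->]; last by rewrite F'0.
      by case: (idtau (F' (lift ord0 j))).
    rewrite big_ord_recl unlift_none big1 ?addr0 // => j _.
    by rewrite liftK.
have stepS e g u v : good (g, e) -> ideal_exp a (test_exponent t p e) u -> S v ->
    S (g (u * v)).
  move=> [/= e_gt0 Tg [z nz]] au; rewrite [X in X v]defS => -[y [Fy ->]].
  rewrite mulr_sumr (cartier_sum _ _ _ (Thom _ _ Tg)).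
  apply: ideal_sum_closed => // i.
  have [d_gt0 Tphi [x nx]] := goodF i.
  apply: (test_ideal_image t_gt0 redR noethR finR aR d_gt0 e_gt0
    (Thom _ _ Tphi) (Thom _ _ Tg) nx nz idS _ au (Fy i)) => k.
  apply: (tauS ((g \o iter k (F i).1), (e + k * (F i).2)%N)); split=> /=.
  - by rewrite addn_gt0 e_gt0.
  - have [_ [_ Tcomp]] := gradT; apply: Tcomp Tg _.
    apply: (sub_alg _ (goodF i)); exact: cyclic_subalgebra_iter.
  - have [x' nx'] := nzd_image_iter k (Thom _ _ Tphi) nx.
    exact: nzd_image_comp (Thom _ _ Tg) (cartier_iter (Thom _ _ Tphi)) nz nx'.
exists n, (fun i => alg (F i)); split.
  move=> i; have [d_gt0 Tphi [y ny]] := goodF i; have hom := Thom _ _ Tphi.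
  have gradi := cyclic_subalgebra_graded d_gt0 hom.
  split=> //; first exact: sub_alg.
    by split=> //; split=> //; exact: cyclic_subalgebra0 hom.
  split; last first.
    exists (F i).2; split=> //; first exact: (cyclic_subalgebra_free d_gt0 hom redR ny).
    by move=> m r _; exact: (cyclic_subalgebra_comp d_gt0 hom redR ny).
  split=> //; exists (F i).2, (F i).1; split=> //.
    by rewrite -[X in alg _ X]mul1n; apply: (cyclic_subalgebra_iter _ _ 1).
  by apply/(nondegenerate_eltP redR noethR hom); exists y.
exists S, (fun i => tau (F i)); split=> //; last first.
  move=> i; have [b Rb taub] := tau_b _ (goodF i).
  have [_ Tphi _] := goodF i.
  exact: (is_big_test_idealP (cyclic_subalgebra_cartier (Thom _ _ Tphi)) Rb).
split; last first.
  move=> J cJ x; rewrite defS => -[y [Fy ->]].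
  apply: ideal_sum_closed => [|i]; first by case: cJ.
  by apply: (Fy i); apply: compatible_ideal_sub cJ; apply: sub_alg.
apply/(compatible_idealP _ _ _ Thom); split=> //.
  have [[e [phi [e_gt0 Tphi ndphi]]] _] := nondeg.
  have goodphi := good_elt _ _ e_gt0 Tphi ndphi.
  have [b Rb taub] := tau_b _ goodphi.
  by exists b; split=> //; apply: tauS taub.
move=> e psi u v Tpsi au Sv.
have [e0 | e_gt0] := posnP e.
  rewrite e0 in Tpsi; rewrite -[u * v]mulr1 -[u * v]expr1.
  rewrite -(cartierZ _ _ (Thom _ _ Tpsi)) -mulrA [v * _]mulrC mulrA.
  by case: idS => _ _; apply.
have [-> | /eqP psi0] := eqVneq psi 0; first by case: idS.
have [m [g [x [gP ->]]]] := genT e e_gt0 (ex_intro2 _ _ psi Tpsi psi0) psi Tpsi.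
rewrite fct_sumE; apply: ideal_sum_closed => // i; rewrite /premul mulrA.
apply: (stepS e); [|  | exact: Sv].
  by have [Tg ndg] := gP i; apply: good_elt.
by case: (ideal_exp_ideal a (test_exponent t p e)) => _ _; apply.
Qed.
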